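(* Let $k,\ell$ be positive integers and $n=k\ell$. The Segre determinant $\mathrm{Seg}_{k,\ell}$ is a polynomial of bi-degree $(\ell,k)$ in the brackets $[I]$, $I\in\binom{[n]}{k}$, and $\langle J\rangle$, $J\in\binom{[n]}{\ell}$; that is, it has degree $\ell$ in the brackets $[I]$ and degree $k$ in the brackets $\langle J\rangle$.
   Context: Let $A=(a_{ij})$ be a $k\times n$ matrix of indeterminates and $B=(b_{ij})$ an $\ell\times n$ matrix of indeterminates over $\mathbb{C}$, with columns $A_1,\dots,A_n$ and $B_1,\dots,B_n$. The Segre determinant $\mathrm{Seg}_{k,\ell}\in\mathbb{C}[a_{ij}]\otimes\mathbb{C}[b_{ij}]$ is the determinant of the $k\ell\times k\ell$ matrix whose $i$-th column is $A_i\otimes B_i\in\mathbb{C}^k\otimes\mathbb{C}^\ell$, i.e. the vector of all products $a_{pi}b_{qi}$ with $1\le p\le k$, $1\le q\le\ell$ (in a fixed order). For $I\in\binom{[n]}{k}$, the bracket $[I]$ is the determinant of the submatrix of $A$ with columns indexed by $I$. For $J\in\binom{[n]}{\ell}$, the bracket $\langle J\rangle$ is the determinant of the submatrix of $B$ with columns indexed by $J$. *)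

(* Defs.v *)
From HB Require Import structures.
From mathcomp Require Import all_boot all_order all_algebra.
From mathcomp Require Import mxtens complex.
From mathcomp Require Export reals.
From mathcomp Require Import mpoly.

Set Implicit Arguments.
Unset Strict Implicit.
Unset Printing Implicit Defensive.

Import GRing.Theory.
Local Open Scope ring_scope.

(* {mpoly C[N]} has its variables indexed by 'I_N; a finite type T of
   variables is used through its canonical enumeration enum_rank. *)
Notation polyring C T := {mpoly C[#|{: T}|]}.

Definition indet (C : comNzRingType) (T : finType) (t : T) : polyring C T :=
  'X_(enum_rank t).

Definition subst (C : comNzRingType) (T U : finType)
    (v : T -> polyring C U) (P : polyring C T) : polyring C U :=
  P \mPo [tuple v (enum_val i) | i < #|{: T}|].

(* Bihomogeneity in the two groups of variables X and Y.  The zero polynomial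
   is excluded, so that the degree in each group is exactly the given one. *)
Definition has_bidegree (C : comNzRingType) (X Y : finType) (d e : nat)
    (P : polyring C (X + Y)%type) : Prop :=
  P != 0 /\
  forall m, m \in msupp P ->
    (\sum_(x : X) m (enum_rank (inl x : X + Y)) = d /\
     \sum_(y : Y) m (enum_rank (inr y : X + Y)) = e)%N.

Notation ksubset n k := {I : {set 'I_n} | #|I| == k}.

(* enum_val lists the elements of I in increasing order. *)
Definition ksubset_elt (n k : nat) (I : ksubset n k) (j : 'I_k) : 'I_n :=
  enum_val (cast_ord (esym (eqP (valP I))) j).

Definition bracket (S : comNzRingType) (k n : nat) (M : 'M[S]_(k, n))
    (I : ksubset n k) : S :=
  \det (colsub (ksubset_elt I) M).

(* The n columns of M and N have length k and l; [colkron M N] has i-th column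
   M_i (x) N_i, with rows ordered by mxtens_index (p, q) = p * l + q.
   The 0 is the only element of 'I_(1 * 1). *)
Definition colkron (S : comNzRingType) (k l n : nat)
    (M : 'M[S]_(k, n)) (N : 'M[S]_(l, n)) : 'M[S]_(k * l, n) :=
  \matrix_(r, i) (col i M *t col i N) r 0.

Section Segre.
Variables (C : comNzRingType) (k l n : nat).

(* C[a_ij] (x) C[b_ij] is taken to be the polynomial ring C[a_ij, b_ij]. *)
Definition entry := ('I_k * 'I_n + 'I_l * 'I_n)%type.

Definition matA : 'M[polyring C entry]_(k, n) :=
  \matrix_(p, i) indet C (inl (p, i) : entry).

Definition matB : 'M[polyring C entry]_(l, n) :=
  \matrix_(q, i) indet C (inr (q, i) : entry).

Definition bracket_var := (ksubset n k + ksubset n l)%type.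

Definition bracket_val (v : bracket_var) : polyring C entry :=
  match v with
  | inl K => bracket matA K
  | inr K => bracket matB K
  end.

End Segre.

Definition Seg (C : comNzRingType) (k l : nat) : polyring C (entry k l (k * l)) :=
  \det (colkron (matA C k l (k * l)) (matB C k l (k * l))).

(* Main.v *)
(* Identify the n = k l column indices with the cells (p, q) of a k x l grid, and
   for a permutation s of the cells multiply the l brackets of A on the columns of
   the grid moved by s with the k brackets of B on its rows moved by s.  The sum of
   these products over s, weighted by the sign of s, is multilinear and alternating
   in the vectors A_i (x) B_i, hence equals c Seg for an integer c.
   That c is nonzero is a positivity argument.  For I : [n] -> [k] let e(I) be the
   sign of the self-map (I, column) of the grid (0 if it is not bijective), and
   let D(I) be the sum of e(I o t) over the group G of permutations t preserving
   the rows of the grid.  Then c = sum_I e(I) D(I), and D is G-invariant, so that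
   |G| c = sum_I D(I)^2, where D(row) = |G|. *)

Require Import Defs.
From mathcomp Require Import all_boot all_order all_algebra all_fingroup.
From mathcomp Require Import mxtens complex mpoly.

Set Implicit Arguments.
Unset Strict Implicit.
Unset Printing Implicit Defensive.

Import GRing.Theory Num.Theory.
Local Open Scope ring_scope.

(** * Row and column coordinates of a cell in the [k] by [l] grid *)

Definition rowi k l (r : 'I_(k * l)) : 'I_k := (mxtens_unindex r).1.
Definition coli k l (r : 'I_(k * l)) : 'I_l := (mxtens_unindex r).2.

Lemma rowi_index k l (p : 'I_k) (q : 'I_l) : rowi (mxtens_index (p, q)) = p.
Proof. by rewrite /rowi mxtens_indexK. Qed.

Lemma coli_index k l (p : 'I_k) (q : 'I_l) : coli (mxtens_index (p, q)) = q.
Proof. by rewrite /coli mxtens_indexK. Qed.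

Lemma index_rowi_coli k l (r : 'I_(k * l)) : mxtens_index (rowi r, coli r) = r.
Proof. by rewrite -surjective_pairing mxtens_unindexK. Qed.

Lemma rowi_coli_inj k l (r s : 'I_(k * l)) :
  rowi r = rowi s -> coli r = coli s -> r = s.
Proof. by move=> eq_row eq_col; rewrite -[r]index_rowi_coli eq_row eq_col index_rowi_coli. Qed.

(** * Determinants of reindexed, block-diagonal and row-selected matrices *)

Lemma det_mxsub_bij (S : comNzRingType) (m n : nat) (f : 'I_m -> 'I_n)
    (W : 'M[S]_n) : bijective f -> \det (mxsub f f W) = \det W.
Proof.
move=> f_bij; have eq_mn : m = n by rewrite -[m]card_ord (bij_eq_card f_bij) card_ord.
case: _ / eq_mn f W f_bij => f W /bij_inj f_inj.
have -> : mxsub f f W = row_perm (perm f_inj) (col_perm (perm f_inj) W).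
  by apply/matrixP => i j; rewrite !mxE !permE.
(* The sign of the reindexing occurs once for the rows and once for the columns, so it cancels. *)
rewrite row_permE col_permE !det_mulmx !det_perm odd_permV mulrCA.
by rewrite -signr_addb addbb mulr1.
Qed.

(** Cells are numbered row by row, so the matrix is block diagonal; the induction peels off the
    block of row [0]. *)
Lemma det_blockdiag_row (S : comNzRingType) (k l : nat) (X : 'I_k -> 'M[S]_l) :
  \det (\matrix_(r, s < k * l)
     (X (rowi r) (coli r) (coli s) *+ (rowi r == rowi s))) = \prod_p \det (X p).
Proof.
elim: k X => [|k IHk] X; first by rewrite det_mx00 big_ord0.
have unl (q : 'I_l) : lshift (k * l) q = mxtens_index (ord0 : 'I_k.+1, q).
  exact: val_inj.
have unr (r : 'I_(k * l)) : rshift l r = mxtens_index (lift ord0 (rowi r), coli r).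
  by apply: val_inj; rewrite /= /bump /= mulSn -addnA -divn_eq.
rewrite big_ord_recl -(IHk (fun p => X (lift ord0 p))).
rewrite -(det_ublock _ 0); congr (\det _).
rewrite -[LHS]submxK; congr block_mx; apply/matrixP => r s; rewrite !mxE.
- by rewrite !unl !rowi_index !coli_index eqxx.
- by rewrite unl unr !rowi_index.
- by rewrite unl unr !rowi_index.
- by rewrite !unr !rowi_index !coli_index (inj_eq lift_inj).
Qed.

(** Transposing the grid turns its columns into rows. The transposition goes from ['I_(l * k)] to
    ['I_(k * l)], which is why [det_mxsub_bij] allows two sizes. *)
Lemma det_blockdiag_col (S : comNzRingType) (k l : nat) (X : 'I_l -> 'M[S]_k) :
  \det (\matrix_(r, s < k * l)
     (X (coli r) (rowi r) (rowi s) *+ (coli r == coli s))) = \prod_q \det (X q).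
Proof.
pose f (r : 'I_(l * k)) : 'I_(k * l) := mxtens_index (coli r, rowi r).
pose g (r : 'I_(k * l)) : 'I_(l * k) := mxtens_index (coli r, rowi r).
have f_bij : bijective f.
  by exists g => r; rewrite /f /g rowi_index coli_index index_rowi_coli.
rewrite -det_blockdiag_row -(det_mxsub_bij _ f_bij); congr (\det _).
by apply/matrixP => r s; rewrite !mxE !rowi_index !coli_index.
Qed.

(* The sign of [h] when [h] is a permutation, and [0] otherwise. *)
Definition sgnf (n : nat) (h : 'I_n -> 'I_n) : int := \det (rowsub h 1%:M).

(** Selecting rows is left multiplication by the 0-1 matrix [rowsub h 1%:M]. *)
Lemma det_rowsub (S : comNzRingType) (n : nat) (h : 'I_n -> 'I_n) (K : 'M[S]_n) :
  \det (rowsub h K) = (sgnf h)%:~R * \det K.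
Proof.
by rewrite /sgnf -(det_map_mx intr) map_mxsub map_mx1 -det_mulmx mul_rowsub_mx mul1mx.
Qed.

Lemma eq_sgnf n (h h' : 'I_n -> 'I_n) : h =1 h' -> sgnf h = sgnf h'.
Proof. by move=> eq_h; congr (\det _); apply/matrixP => i j; rewrite !mxE eq_h. Qed.

Lemma sgnf_perm n (s : 'S_n) : sgnf s = (-1) ^+ s.
Proof. by rewrite -det_perm; congr (\det _); apply/matrixP => i j; rewrite !mxE. Qed.

Lemma sgnf_comp_perm n (h : 'I_n -> 'I_n) (s : 'S_n) :
  sgnf (fun r => h (s r)) = (-1) ^+ s * sgnf h.
Proof.
rewrite -sgnf_perm /sgnf -det_mulmx mul_rowsub_mx mul1mx.
by congr (\det _); apply/matrixP => i j; rewrite !mxE.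
Qed.

Lemma sgnf_expand n (h : 'I_n -> 'I_n) :
  sgnf h = \sum_(s : 'S_n) (-1) ^+ s *+ [forall r, s r == h r].
Proof.
apply: eq_bigr => s _; rewrite -mulr_natr; congr (_ * _).
case: (boolP [forall r, s r == h r]) => [/forallP eq_sh | /forallPn[r neq_r]].
  by rewrite big1 // => r _; rewrite !mxE (eqP (eq_sh r)) eqxx.
by rewrite (bigD1 r) //= !mxE eq_sym (negPf neq_r) mul0r.
Qed.

(** * Permutations preserving grid rows or columns, and products of minors *)

Definition rowstab k l := [set s : 'S_(k * l) | [forall r, rowi (s r) == rowi r]].
Definition colstab k l := [set s : 'S_(k * l) | [forall r, coli (s r) == coli r]].

Lemma rowstabP k l (s : 'S_(k * l)) :
  reflect (forall r, rowi (s r) = rowi r) (s \in rowstab k l).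
Proof. by rewrite inE; apply: 'forall_eqP. Qed.

Lemma colstabP k l (s : 'S_(k * l)) :
  reflect (forall r, coli (s r) = coli r) (s \in colstab k l).
Proof. by rewrite inE; apply: 'forall_eqP. Qed.

Lemma rowstab_group_set k l : group_set (rowstab k l).
Proof.
apply/group_setP; split=> [|s t /rowstabP s_row /rowstabP t_row].
  by apply/rowstabP => r; rewrite perm1.
by apply/rowstabP => r; rewrite permM t_row s_row.
Qed.
Canonical rowstab_group k l := Group (rowstab_group_set k l).

Lemma prod_det_cols (S : comNzRingType) (k l n : nat) (M : 'M[S]_(k, n))
    (g : 'I_(k * l) -> 'I_n) :
  \prod_q \det (colsub (fun p => g (mxtens_index (p, q))) M) =
  \sum_(s in colstab k l) (-1) ^+ s * \prod_r M (rowi (s r)) (g r).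
Proof.
(* The nonzero terms of the Leibniz formula come from permutations preserving
   the blocks. *)
rewrite -det_blockdiag_col -det_tr [RHS]big_mkcond; apply: eq_bigr => s _.
case: colstabP => [s_col | s_ncol].
  congr (_ * _); apply: eq_bigr => r _; rewrite !mxE s_col eqxx.
  by rewrite index_rowi_coli.
have [/forallP s_col | /forallPn[r neq_r]] := boolP [forall r, coli (s r) == coli r].
  by case: s_ncol => r; apply/eqP.
by rewrite (bigD1 r) //= !mxE (negPf neq_r) mul0r mulr0.
Qed.

Lemma prod_det_rows (S : comNzRingType) (k l n : nat) (N : 'M[S]_(l, n))
    (g : 'I_(k * l) -> 'I_n) :
  \prod_p \det (colsub (fun q => g (mxtens_index (p, q))) N) =
  \sum_(s in rowstab k l) (-1) ^+ s * \prod_r N (coli (s r)) (g r).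
Proof.
rewrite -det_blockdiag_row -det_tr [RHS]big_mkcond; apply: eq_bigr => s _.
case: rowstabP => [s_row | s_nrow].
  congr (_ * _); apply: eq_bigr => r _; rewrite !mxE s_row eqxx.
  by rewrite index_rowi_coli.
have [/forallP s_row | /forallPn[r neq_r]] := boolP [forall r, rowi (s r) == rowi r].
  by case: s_nrow => r; apply/eqP.
by rewrite (bigD1 r) //= !mxE (negPf neq_r) mul0r mulr0.
Qed.

(** * The alternating sum of bracket products as a multiple of the Segre determinant *)

Definition bracket_sum (S : comNzRingType) (k l : nat)
    (M : 'M[S]_(k, k * l)) (N : 'M[S]_(l, k * l)) : S :=
  \sum_(s : 'S_(k * l)) (-1) ^+ s *
    (\prod_q \det (colsub (fun p => s (mxtens_index (p, q))) M) *
     \prod_p \det (colsub (fun q => s (mxtens_index (p, q))) N)).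

(** Here [s] comes from expanding the minors of [M] and [t] from those of [N]. The combined map need
    not be bijective, hence [sgnf]. *)
Definition bracket_sum_coef (k l : nat) : int :=
  \sum_(s in colstab k l) \sum_(t in rowstab k l)
    (-1) ^+ s * (-1) ^+ t *
    sgnf (fun r => mxtens_index (rowi (s r), coli (t r))).

(** For fixed [s] and [t], the sum over [u] is the Leibniz formula for [colkron M N] with rows
    selected by the combined map; [det_rowsub] then extracts its sign. *)
Lemma bracket_sum_colkron (S : comNzRingType) (k l : nat)
    (M : 'M[S]_(k, k * l)) (N : 'M[S]_(l, k * l)) :
  bracket_sum M N = (bracket_sum_coef k l)%:~R * \det (colkron M N).
Proof.
rewrite /bracket_sum /bracket_sum_coef rmorph_sum mulr_suml /=.
under [LHS]eq_bigr => u _.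
  rewrite (prod_det_cols M u) (prod_det_rows N u) big_distrlr mulr_sumr /=.
  under eq_bigr => s _ do rewrite mulr_sumr.
  over.
rewrite exchange_big; apply: eq_bigr => s _ /=.
rewrite exchange_big rmorph_sum mulr_suml; apply: eq_bigr => t _ /=.
rewrite !rmorphM !rmorphXn !rmorphN1 -!mulrA -det_rowsub.
rewrite !mulr_sumr; apply: eq_bigr => u _.
rewrite mulrACA [LHS]mulrCA -!mulrA; do 3 congr (_ * _).

rewrite -big_split; apply: eq_bigr => r _ /=.
by rewrite !mxE -/(rowi _) -/(coli _) rowi_index coli_index.
Qed.

(** * The integer coefficient is nonzero *)

Section BracketSumCoef.
Variables k l : nat.
Implicit Type I : {ffun 'I_(k * l) -> 'I_k}.

(** The function [e(I)]: each cell gets the new row [I r] and keeps its column. *)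
Definition sgnrow I : int := sgnf (fun r => mxtens_index (I r, coli r)).

Definition ffun_perm I (t : 'S_(k * l)) := [ffun r => I (t r)].

(** The function [D(I)], with [rowstab k l] as the group [G]. *)
Definition symrow I : int := \sum_(t in rowstab k l) sgnrow (ffun_perm I t).

Lemma symrow_perm I t : t \in rowstab k l -> symrow (ffun_perm I t) = symrow I.
Proof.
move=> t_row; rewrite /symrow (reindex_inj (mulIg t^-1)%g) /=.
rewrite (eq_bigl (mem (rowstab k l))) => [|u]; last first.
  by rewrite /= (@groupMr _ (rowstab_group k l)) ?groupV.
apply: eq_bigr => u _; congr sgnrow; apply/ffunP => r.
by rewrite !ffunE permM permKV.
Qed.

(** A permutation of the form [(I r, coli r)] preserves columns, and a column-preserving permutation
    is determined by its row part. *)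
Lemma sgnrow_expand I :
  sgnrow I = \sum_(s in colstab k l)
    (-1) ^+ s *+ (I == [ffun r => rowi (s r)]).
Proof.
rewrite /sgnrow sgnf_expand [RHS]big_mkcond; apply: eq_bigr => s _.
case: colstabP => [s_col | s_ncol].
  congr (_ *+ nat_of_bool _); apply/'forall_eqP/eqP => [eq_s | -> r].
    by apply/ffunP => r; rewrite ffunE eq_s rowi_index.
  by rewrite ffunE -[coli r]s_col index_rowi_coli.
rewrite [X in _ *+ nat_of_bool X](_ : _ = false) //.
by apply/negbTE/negP => /'forall_eqP eq_s; case: s_ncol => r; rewrite eq_s coli_index.
Qed.

Lemma bracket_sum_coefE :
  bracket_sum_coef k l = \sum_I sgnrow I * symrow I.
Proof.
under [RHS]eq_bigr => I _ do rewrite sgnrow_expand mulr_suml.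
rewrite exchange_big; apply: eq_bigr => s _ /=.
rewrite (bigD1 [ffun r => rowi (s r)]) //= eqxx mulr1n [X in _ + X]big1 ?addr0; last first.
  by move=> I /negPf ->; rewrite mul0r.
(* With [t] inverted, its sign is absorbed by precomposing with [t], which restores the column
   coordinate and turns the row part into [I] composed with [t]. *)
rewrite mulr_sumr (reindex_inj invg_inj) /=.
apply: eq_big => [t | t _]; first exact: (@groupV _ (rowstab_group k l)).
rewrite -mulrA; congr (_ * _); rewrite odd_permV -sgnf_comp_perm.
by apply: eq_sgnf => r; rewrite !ffunE permK.
Qed.

(** For each [t], replacing [I] by [ffun_perm I t] keeps the total and the factor [symrow I];
    summing over [t] turns the other factor into [symrow I] as well. *)
Lemma bracket_sum_coef_sqr :
  bracket_sum_coef k l *+ #|rowstab k l| = \sum_I symrow I ^+ 2.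
Proof.
have perm_bij t : bijective (ffun_perm^~ t).
  by exists (ffun_perm^~ t^-1%g) => I; apply/ffunP => r; rewrite !ffunE (permK, permKV).
rewrite -sumr_const; under [RHS]eq_bigr => I _ do rewrite expr2 {1}/symrow mulr_suml.
rewrite [RHS]exchange_big; apply: eq_bigr => t t_row /=.
rewrite bracket_sum_coefE (reindex _ (onW_bij _ (perm_bij t))) /=.
by apply: eq_bigr => I _; rewrite symrow_perm.
Qed.

Lemma bracket_sum_coef_neq0 : bracket_sum_coef k l != 0.
Proof.
have card_gt0 : (0 < #|rowstab k l|)%N by apply: (cardG_gt0 (rowstab_group k l)).
(* Row-preserving permutations fix the function [rowi], so every term is the sign of the
   identity. *)
have symrow_rowi : symrow [ffun r => rowi r] = #|rowstab k l|%:R.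
  rewrite -sumr_const; apply: eq_bigr => t /rowstabP t_row.
  transitivity (sgnf (1%g : 'S_(k * l))); last by rewrite sgnf_perm odd_perm1.
  apply: eq_sgnf => r.
  by rewrite !ffunE t_row index_rowi_coli perm1.
apply/eqP => coef0; have /eqP := bracket_sum_coef_sqr.
rewrite coef0 mul0rn eq_sym (psumr_eq0 _ (fun I _ => sqr_ge0 (symrow I))) => /allP.
move=> /(_ [ffun r => rowi r]); rewrite mem_index_enum symrow_rowi => /(_ isT).
by rewrite /= expf_eq0 pnatr_eq0 gtn_eqF.
Qed.

End BracketSumCoef.

(** * Bihomogeneous expressions in the brackets *)

Section BihomogeneousSubst.
Variables (C : comNzRingType) (X Y U : finType) (v : X + Y -> polyring C U).
Implicit Types (d e : nat) (Q : polyring C U).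

Definition bihomogeneous d e (P : polyring C (X + Y)%type) : Prop :=
  forall m, m \in msupp P ->
    (\sum_(x : X) m (enum_rank (inl x : X + Y)) = d /\
     \sum_(y : Y) m (enum_rank (inr y : X + Y)) = e)%N.

Definition bihom_in d e Q : Prop :=
  exists2 P, bihomogeneous d e P & Q = subst v P.

Lemma bihom_in0 d e : bihom_in d e 0.
Proof. by exists 0; [move=> m; rewrite msupp0 | rewrite /subst comp_mpoly0]. Qed.

Lemma bihom_inD d e Q Q' : bihom_in d e Q -> bihom_in d e Q' -> bihom_in d e (Q + Q').
Proof.
move=> [P homP ->] [P' homP' ->]; exists (P + P'); last by rewrite /subst comp_mpolyD.
by move=> m /msuppD_le; rewrite mem_cat => /orP[/homP | /homP'].
Qed.

Lemma bihom_inZ d e c Q : bihom_in d e Q -> bihom_in d e (c *: Q).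
Proof.
move=> [P homP ->]; exists (c *: P); last by rewrite /subst comp_mpolyZ.
by move=> m /msuppZ_le /homP.
Qed.

Lemma bihom_in_sign d e (b : bool) Q : bihom_in d e Q -> bihom_in d e ((-1) ^+ b * Q).
Proof.
by move=> homQ; rewrite mulr_sign -scaleN1r; case: b => //; apply: bihom_inZ.
Qed.

Lemma bihom_in_sum d e (I : finType) (F : I -> polyring C U) :
  (forall i, bihom_in d e (F i)) -> bihom_in d e (\sum_i F i).
Proof.
by move=> homF; apply: big_ind => [|Q Q' | i _]; [exact: bihom_in0 | exact: bihom_inD |].
Qed.

Lemma bihom_in1 : bihom_in 0 0 1.
Proof.
exists 1; last by rewrite /subst comp_mpoly1.
by move=> m; rewrite msupp1 inE => /eqP ->; split; apply: big1 => t _; rewrite mnm0E.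
Qed.

Lemma bihom_inM d e d' e' Q Q' :
  bihom_in d e Q -> bihom_in d' e' Q' -> bihom_in (d + d') (e + e') (Q * Q').
Proof.
move=> [P homP ->] [P' homP' ->]; exists (P * P'); last by rewrite /subst rmorphM.
move=> m /msuppM_le /allpairsP[[m1 m2] /= [/homP[<- <-] /homP'[<- <-] ->]].
by split; rewrite -big_split; apply: eq_bigr => t _; rewrite mnmDE.
Qed.

Lemma bihom_in_prod d e n (F : 'I_n -> polyring C U) :
  (forall i, bihom_in d e (F i)) -> bihom_in (n * d) (n * e) (\prod_i F i).
Proof.
elim: n F => [|n IHn] F homF; first by rewrite big_ord0; apply: bihom_in1.
by rewrite big_ord_recl !mulSn; apply: bihom_inM => //; apply: IHn => i.
Qed.

Lemma subst_indet t : subst v (indet C t) = v t.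
Proof.
by rewrite /subst comp_mpolyXU -tnth_nth tnth_mktuple enum_rankK.
Qed.

Lemma bihom_in_inl x : bihom_in 1 0 (v (inl x)).
Proof.
rewrite -subst_indet; exists (indet C (inl x : X + Y)) => // m.
rewrite /indet msuppX inE => /eqP ->; split.
  rewrite (bigD1 x) //= mnm1E eqxx big1 // => x' /negPf neq_x.
  by rewrite mnm1E (inj_eq enum_rank_inj) (inj_eq inl_inj) eq_sym neq_x.
by rewrite big1 // => y _; rewrite mnm1E (inj_eq enum_rank_inj).
Qed.

Lemma bihom_in_inr y : bihom_in 0 1 (v (inr y)).
Proof.
rewrite -subst_indet; exists (indet C (inr y : X + Y)) => // m.
rewrite /indet msuppX inE => /eqP ->; split.
  by rewrite big1 // => x _; rewrite mnm1E (inj_eq enum_rank_inj).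
rewrite (bigD1 y) //= mnm1E eqxx big1 // => y' /negPf neq_y.
by rewrite mnm1E (inj_eq enum_rank_inj) (inj_eq inr_inj) eq_sym neq_y.
Qed.

End BihomogeneousSubst.

(** A repeated column kills the minor; otherwise sorting the columns into increasing order costs
    only a sign. *)
Lemma det_colsub (S : comNzRingType) (k n : nat) (M : 'M[S]_(k, n)) (f : 'I_k -> 'I_n) :
  \det (colsub f M) = 0 \/
  exists (b : bool) (I : ksubset n k), \det (colsub f M) = (-1) ^+ b * bracket M I.
Proof.
have [f_inj | /injectivePn[i [j neq_ij eq_f]]] := altP (injectiveP f); last first.
  left; rewrite -det_tr; apply: (determinant_alternate neq_ij) => r.
  by rewrite !mxE eq_f.
right; have card_f : #|f @: setT| == k by rewrite card_imset ?cardsT ?card_ord.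
pose I : ksubset n k := exist _ (f @: setT) card_f.
(* The position of [f j] in the increasing enumeration of the image of [f]. *)
pose g (j : 'I_k) := cast_ord (eqP card_f) (enum_rank_in (imset_f f (in_setT j)) (f j)).
have gK j : ksubset_elt I (g j) = f j.
  rewrite /ksubset_elt /g.
  rewrite [cast_ord _ _](_ : _ = enum_rank_in (imset_f f (in_setT j)) (f j)).
    by rewrite enum_rankK_in // imset_f.
  exact: val_inj.
have g_inj : injective g by move=> i j eq_g; apply: f_inj; rewrite -!gK eq_g.
exists (perm g_inj), I.
have -> : colsub f M = col_perm (perm g_inj) (colsub (ksubset_elt I) M).
  by apply/matrixP => r j; rewrite !mxE permE gK.
by rewrite col_permE det_mulmx det_perm odd_permV mulrC.
Qed.

Lemma bracket_sum_bihom (C : comNzRingType) (k l : nat) :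
  bihom_in (@bracket_val C k l (k * l)) l k (bracket_sum (matA C k l _) (matB C k l _)).
Proof.
have bihom_detA f : bihom_in (@bracket_val C k l (k * l)) 1 0 (\det (colsub f (matA C k l _))).
  have [-> | [b [I ->]]] := det_colsub (matA C k l _) f; first exact: bihom_in0.
  by apply: bihom_in_sign; apply: (bihom_in_inl (@bracket_val C k l (k * l))).
have bihom_detB f : bihom_in (@bracket_val C k l (k * l)) 0 1 (\det (colsub f (matB C k l _))).
  have [-> | [b [I ->]]] := det_colsub (matB C k l _) f; first exact: bihom_in0.
  by apply: bihom_in_sign; apply: (bihom_in_inr (@bracket_val C k l (k * l))).
apply: bihom_in_sum => s; apply: bihom_in_sign.
(* One factor of bidegree [(1, 0)] per grid column and one of bidegree [(0, 1)] per grid row. *)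
have := bihom_inM (bihom_in_prod (fun q : 'I_l => bihom_detA (fun p => s (mxtens_index (p, q)))))
  (bihom_in_prod (fun p : 'I_k => bihom_detB (fun q => s (mxtens_index (p, q))))).
by rewrite !muln0 !muln1 addn0 add0n.
Qed.

(** * Nonvanishing of the Segre determinant, and the conclusion *)

Lemma Seg_neq0 (C : comNzRingType) (k l : nat) : Seg C k l != 0.
Proof.
(* At this point column [r] of each matrix is the basis vector indexed by [rowi r], respectively
   [coli r], so the Segre matrix becomes the identity. *)
pose w (t : entry k l (k * l)) : C :=
  match t with
  | inl (p, r) => (p == rowi r)%:R
  | inr (q, r) => (q == coli r)%:R
  end.
have evalE t : (indet C t).@[fun i => w (enum_val i)] = w t.
  by rewrite mevalXU enum_rankK.
suff eval1 : (Seg C k l).@[fun i => w (enum_val i)] = 1.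
  by apply: contra_eq_neq eval1 => ->; rewrite meval0 eq_sym oner_eq0.
rewrite -det_map_mx -[RHS](det1 _ (k * l)); congr (\det _).
apply/matrixP => r s; rewrite !mxE -/(rowi _) -/(coli _) rmorphM /= !evalE /=.
rewrite -natrM mulnb; congr (nat_of_bool _)%:R.
by apply/andP/eqP => [[/eqP eq_row /eqP eq_col] | ->]; [apply: rowi_coli_inj |].
Qed.

Local Close Scope ring_scope.

Theorem proposition2p2 (R : realType) (k l : nat) (hk : 0 < k) (hl : 0 < l) :
  exists P : polyring (complex R) (bracket_var k l (k * l)),
    has_bidegree l k P /\
    Seg (complex R) k l = subst (@bracket_val (complex R) k l (k * l)) P.
Proof.
pose c : complex R := ((bracket_sum_coef k l)%:~R)%R.
(* Characteristic zero keeps the nonzero integer invertible in the field. *)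
have c_neq0 : (c != 0)%R by rewrite intr_eq0 bracket_sum_coef_neq0.
have [P homP SegE] := bihom_inZ (c^-1)%R (bracket_sum_bihom (complex R) k l).
rewrite bracket_sum_colkron mulrzl -scaler_int scalerA mulVf // scale1r in SegE.
exists P; split=> //; split=> //.
(* If [P] were zero, its substitution [Seg] would vanish. *)
apply: contra_eq_neq SegE => ->; rewrite /subst comp_mpoly0.
exact: Seg_neq0.
Qed.
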